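(* Let $G:\mathbb{R}\to\mathbb{R}$ be a solution of the integral equation $$G(x) = \int_{-x}^\infty (1+G(y))\,e^{-G(y)}\, dy \qquad (x\in\mathbb{R}),$$ and for $x>0$ let $y=y(x)>0$ be defined by $$\left(1+\frac x2\right)e^{-x} + \left(1+\frac y2\right)e^{-y} = 1 .$$ Then $$\frac12\int_{-\infty}^{+\infty} G(x)\,(1+G(x))\,e^{-G(x)}\, dx \;=\; \frac12\int_0^\infty y(x)\,dx .$$
   Context: For each $x>0$ the equation $(1+\frac x2)e^{-x}+(1+\frac y2)e^{-y}=1$ has exactly one solution $y>0$, so $y$ is a well-defined function of $x>0$. The left-hand side of the claimed identity is the cavity/replica characterization of the limit length $L^\star_{TSP}$ of the mean field traveling salesman problem, and the right-hand side is another characterization of the same limit; the claim is that the two expressions are equal. *)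

(* Defs.v *)
From HB Require Import structures.
From mathcomp Require Import all_boot all_order all_algebra.
From mathcomp Require Import all_classical all_reals all_analysis.

Set Implicit Arguments.
Unset Strict Implicit.
Unset Printing Implicit Defensive.

Import Order.TTheory GRing.Theory Num.Theory.
Import numFieldNormedType.Exports.
Local Open Scope classical_set_scope.
Local Open Scope ring_scope.

(* All integrals are Lebesgue integrals. The real-valued integral [\int] of
   [ring_scope] is total (it is 0 when the extended-real integral is infinite),
   so it is always paired with integrability of the integrand. *)
Definition solves_integral_equation (R : realType) (G : R -> R) : Prop :=
  forall x : R,
    (@lebesgue_measure R).-integrable `[- x, +oo[
      (fun y => ((1 + G y) * expR (- G y))%:E) /\
    G x = \int[@lebesgue_measure R]_(y in `[- x, +oo[)
            ((1 + G y) * expR (- G y)).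

(* Only the values of [y] on ]0, +oo[ matter; there they are uniquely
   determined, since for each [x > 0] the equation has exactly one positive
   root. *)
Definition solves_implicit_equation (R : realType) (y : R -> R) : Prop :=
  forall x : R, 0 < x ->
    0 < y x /\
    (1 + x / 2) * expR (- x) + (1 + y x / 2) * expR (- y x) = 1.

(* Main.v *)
Require Import Defs.
From HB Require Import structures.
From mathcomp Require Import all_boot all_order all_algebra.
From mathcomp Require Import all_classical all_reals all_analysis.
From mathcomp Require Import measurable_realfun ring lra.

Set Implicit Arguments.
Unset Strict Implicit.
Unset Printing Implicit Defensive.

Import Order.TTheory GRing.Theory Num.Theory.
Import numFieldNormedType.Exports.
Local Open Scope classical_set_scope.
Local Open Scope ring_scope.

(** Write [decay t = (1 + t) e^(-t)] and [balance t = (1 + t / 2) e^(-t)], so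
    that [balance' = - decay / 2].

    The integral equation says that [G (- x)] is the integral of [decay \o G]
    over the half-line from [x]. Hence [G] is continuous, and then differentiable with
    [G'(x) = decay (G (- x))]. The quantity
    [balance (G x) + balance (G (- x))] therefore has derivative 0. As [x]
    grows, [G (- x)] is the tail of a convergent integral and tends to 0, so
    [G'(x)] tends to 1 and [G x] tends to [+oo]; the constant is thus
    [balance 0 = 1] ([balance_solution]). This is the implicit equation: once
    [G] is known to be positive ([solution_gt0]), [G (- x) = y (G x)].

    Consequently [G (- x) decay (G (- x)) = y (G x) G'(x)]. Since [G] increases
    from 0 to [+oo], the substitution [t = G x] turns the integral of the
    left-hand side over the line into the integral of [y] over the positive
    half-line, and the reflection of [x] turns it into the integral of [G decay(G)].

    All this takes place between nonnegative integrals; it remains to see that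
    they are finite. For [x >= 0], [G x] grows at least linearly, because
    [G' >= decay (G 0) > 0] there, and both [G x decay (G x)] and
    [G (- x) decay (G (- x))] are at most a multiple of [e^(- G x / 2)]: the
    first because half of the exponent absorbs the polynomial factor, the second
    because [t decay t] is at most a multiple of [1 - balance t], which at
    [t = G (- x)] equals [balance (G x)]. *)

(** * Elementary estimates *)

Definition decay {R : realType} (t : R) : R := (1 + t) * expR (- t).
(** The left-hand side of the implicit equation is [balance x + balance y]. *)
Definition balance {R : realType} (t : R) : R := (1 + t / 2) * expR (- t).

Section calculus.
Context {R : realType}.
Implicit Types s t : R.

Lemma is_derive_affine_expRN (a b t : R) :
  is_derive t 1 (fun s => (a + b * s) * expR (- s))
    ((b - a - b * t) * expR (- t)).
Proof.
by apply: is_derive_eq; rewrite /GRing.scale /=; ring.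
Qed.

Lemma is_derive_decay t : is_derive t 1 decay (- t * expR (- t)).
Proof.
have := is_derive_affine_expRN 1 1 t.
have -> : (fun s : R => (1 + 1 * s) * expR (- s)) = decay.
  by apply/funext => s; rewrite /decay mul1r.
by move=> h; apply: is_derive_eq; congr (_ * _); ring.
Qed.

Lemma is_derive_balance t : is_derive t 1 balance (- (decay t / 2)).
Proof.
have := is_derive_affine_expRN 1 2^-1 t.
have -> : (fun s : R => (1 + 2^-1 * s) * expR (- s)) = balance.
  by apply/funext => s; rewrite /balance (mulrC _^-1).
by move=> h; apply: is_derive_eq; rewrite /decay; field.
Qed.

Lemma continuous_decay : continuous (@decay R).
Proof.
move=> t; apply: differentiable_continuous; apply/derivable1_diffP.
by have [] := is_derive_decay t.
Qed.

Lemma continuous_balance : continuous (@balance R).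
Proof.
move=> t; apply: differentiable_continuous; apply/derivable1_diffP.
by have [] := is_derive_balance t.
Qed.

Lemma decay0 : decay 0 = 1 :> R.
Proof. by rewrite /decay addr0 oppr0 expR0 mulr1. Qed.

Lemma balance0 : balance 0 = 1 :> R.
Proof. by rewrite /balance mul0r addr0 oppr0 expR0 mulr1. Qed.

Lemma decay_gt0 t : 0 <= t -> 0 < decay t.
Proof. by move=> t0; rewrite mulr_gt0 ?expR_gt0//; lra. Qed.

Lemma balance_gt0 t : 0 <= t -> 0 < balance t.
Proof. by move=> t0; rewrite mulr_gt0 ?expR_gt0//; lra. Qed.

Lemma decay_le s t : 0 <= s -> s <= t -> decay t <= decay s.
Proof.
move=> s0; rewrite le_eqVlt => /predU1P[->//|st].
have [|c] := MVT st (fun x _ => is_derive_decay x).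
  by apply: continuous_subspaceT; exact: continuous_decay.
rewrite in_itv/= => /andP[sc ct] kE.
rewrite -subr_le0 kE mulr_le0_ge0 ?subr_ge0 ?(ltW st)//.
by rewrite mulNr oppr_le0 mulr_ge0 ?expR_ge0//; lra.
Qed.

Lemma balance_lt s t : 0 <= s -> s < t -> balance t < balance s.
Proof.
move=> s0 st.
have [|c] := MVT st (fun x _ => is_derive_balance x).
  by apply: continuous_subspaceT; exact: continuous_balance.
rewrite in_itv/= => /andP[sc ct] bE.
rewrite -subr_lt0 bE pmulr_llt0 ?subr_gt0//.
by rewrite oppr_lt0 divr_gt0// decay_gt0//; lra.
Qed.

Lemma balance_inj s t : 0 <= s -> 0 <= t -> balance s = balance t -> s = t.
Proof.
move=> s0 t0 e; have [st|st|//] := ltgtP s t.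
  by have := balance_lt s0 st; rewrite e ltxx.
by have := balance_lt t0 st; rewrite e ltxx.
Qed.

Lemma expR_half_sqr t : expR t = expR (t / 2) * expR (t / 2).
Proof. by rewrite -expRD; congr expR; field. Qed.

Lemma balance_le_exp t : 0 <= t -> balance t <= expR (- (t / 2)).
Proof.
move=> t0; rewrite /balance expR_half_sqr mulrA mulNr ler_piMl ?expR_ge0//.
by rewrite expRN ler_pdivrMr ?expR_gt0// mul1r expR_ge1Dx.
Qed.

(** From [4 e^(t / 4) >= 4 + t], squared. *)
Lemma mul_decay_le_exp t : 0 <= t -> t * decay t <= 16 * expR (- (t / 2)).
Proof.
move=> t0; rewrite /decay expR_half_sqr mulNr !mulrA ler_wpM2r ?expR_ge0//.
rewrite expRN ler_pdivrMr ?expR_gt0//.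
rewrite expR_half_sqr; have := expR_ge1Dx (t / 2 / 2).
set e := expR _; move=> he.
nra.
Qed.

(** Near 0 both sides are of first order, so that the integrand where [G] is
    small is controlled by [balance] where [G] is large. After multiplication by
    [e^t] this follows from [e^t >= (1 + t / 2)^2]. *)
Lemma mul_decay_le_balance t : 0 <= t -> t * decay t <= 4 * (1 - balance t).
Proof.
move=> t0; rewrite /decay /balance expRN.
have ht := expR_gt0 t.
rewrite mulrA ler_pdivrMr// -mulrA mulrBl mul1r divfK ?gt_eqF//.
rewrite expR_half_sqr; have := expR_ge1Dx (t / 2).
set e := expR _; move=> he; nra.
Qed.
End calculus.

(** * Tails of convergent integrals *)

Section tail_integral.
Context {R : realType}.
Notation mu := (@lebesgue_measure R).
Implicit Types (f : R -> R) (a x : R).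

Definition tail_integral f x : R := \int[mu]_(t in `[x, +oo[) f t.

Lemma integrable_tail f a x : a <= x ->
  mu.-integrable `[a, +oo[ (EFin \o f) -> mu.-integrable `[x, +oo[ (EFin \o f).
Proof.
move=> ax; apply: integrableS => //; apply: subset_itvr.
by rewrite bnd_simp.
Qed.

Lemma tail_integral_split f a x : a <= x ->
  mu.-integrable `[a, +oo[ (EFin \o f) ->
  tail_integral f x = tail_integral f a - \int[mu]_(t in `[a, x]) f t.
Proof.
move=> ax itf; rewrite /tail_integral Rintegral_itvB ?bnd_simp//.
rewrite Rintegral_itv_obnd_cbnd//.
apply: integrableS (integrable_tail ax itf) => //.
by apply: subset_itvr; rewrite bnd_simp.
Qed.

(** The integrand may change sign, so monotone convergence is applied to the
    tails of [`|f|], which dominate those of [f]. *)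
Lemma tail_integral_cvg0 f a : mu.-integrable `[a, +oo[ (EFin \o f) ->
  tail_integral f x @[x --> +oo] --> 0.
Proof.
move=> itf; pose h t : R := `|f t|.
pose A n := `[a, a + n%:R]%classic.
have UA : \bigcup_n A n = `[a, +oo[%classic by rewrite -itv_bndy_bigcup_BRight.
have ith : mu.-integrable `[a, +oo[ (EFin \o h) by exact: integrable_norm.
have itsub n : mu.-integrable `[a, a + n%:R] (EFin \o h).
  by apply: integrableS ith => //; apply: subset_itvl.
have hT : (fun n => \int[mu]_(t in `[a, a + n%:R]) h t) @ \oo -->
    tail_integral h a.
  have -> : tail_integral h a = fine (\int[mu]_(t in \bigcup_n A n)
      (h t)%:E)%E.
    by rewrite UA.
  apply: fine_cvg; rewrite fineK; last first.
    by rewrite UA; exact: integrable_fin_num.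
  apply: ge0_nondecreasing_set_cvg_integral => //.
  - apply/nondecreasing_seqP => n; rewrite subsetEset; apply: subset_itvl.
    by rewrite bnd_simp lerD2l ler_nat.
  - by move=> n; exact: (measurable_int mu (itsub n)).
  - by move=> n x _; rewrite lee_fin normr_ge0.
apply/cvgrPdist_le => e e0.
move/cvgrPdist_le : hT => /(_ e e0) [N _ /(_ N (leqnn N)) /= Ne].
have aN : a <= a + N%:R by rewrite lerDl.
near=> x; rewrite sub0r normrN.
have Nx : a + N%:R <= x by near: x; apply: nbhs_pinfty_ge; exact: num_real.
have ax := le_trans aN Nx.
apply: le_trans (le_normr_Rintegral _ (integrable_tail ax itf)) _ => //.
apply: le_trans Ne; apply: le_trans (ler_norm _).
rewrite -(tail_integral_split aN ith).
change (tail_integral h x <= tail_integral h (a + N%:R)).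
rewrite (tail_integral_split Nx (integrable_tail aN ith)) gerBl.
by apply: Rintegral_ge0 => t _; exact: normr_ge0.
Unshelve. all: by end_near. Qed.

(** Continuity needs no regularity of [f]. For [f = decay \o G] it yields the
    continuity of [G], hence of [f], and only then does the fundamental theorem
    of calculus apply. *)
Lemma continuous_tail_integral f :
  (forall a, mu.-integrable `[a, +oo[ (EFin \o f)) ->
  continuous (tail_integral f).
Proof.
move=> itf x; have x1 : x - 1 < x + 1 by lra.
pose P z := tail_integral f (x - 1) - \int[mu]_(t in `[x - 1, z]) f t.
have cP : {for x, continuous P}.
  apply: cvgB; first exact: cvg_cst.
  apply: (within_continuous_continuous x1); last by rewrite in_itv/=; lra.
  apply: (parameterized_integral_continuous (ltW x1)).
  by apply: integrableS (itf (x - 1)) => //; apply: subset_itvl.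
have PE : \forall z \near x, P z = tail_integral f z.
  near=> z; apply/esym/tail_integral_split => //.
  by apply: ltW; near: z; apply: lt_nbhsr; lra.
have Px : P x = tail_integral f x := nbhs_singleton PE.
rewrite /continuous_at -Px; apply: cvg_trans cP.
exact: near_eq_cvg.
Unshelve. all: by end_near. Qed.

Lemma is_derive_tail_integral f x :
  (forall a, mu.-integrable `[a, +oo[ (EFin \o f)) -> continuous f ->
  is_derive x 1 (tail_integral f) (- f x).
Proof.
move=> itf cf.
pose P z := \int[mu]_(t in `[x - 1, z]) f t.
have x1 : x < x + 1 by lra.
have xm1 : x - 1 < x by lra.
have [|||] := @continuous_FTC1_closed _ f (x - 1) x (x + 1) x1.
- by apply: integrableS (itf (x - 1)) => //; apply: subset_itvl.
- exact: xm1.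
- exact: cf.
rewrite -/P => dP PE.
have isP : is_derive x 1 P (f x) by rewrite -PE derive1E; apply: derivableP.
apply: (@near_eq_is_derive _ _ _ (cst (tail_integral f (x - 1)) - P)).
  near=> z; rewrite /= fctE/=; apply/esym/tail_integral_split => //.
  by apply: ltW; near: z; exact: lt_nbhsr.
by apply: is_derive_eq; rewrite sub0r.
Unshelve. all: by end_near. Qed.
End tail_integral.

(** * The solution of the integral equation *)

Lemma balance_cvg0 {R : realType} : balance t @[t --> +oo] --> (0 : R).
Proof.
apply: (@squeeze_cvgr _ _ _ _ (cst (0 : R)) (fun t : R => expR (- (t / 2)))).
- near=> t; have t0 : 0 <= t.
    by near: t; apply: nbhs_pinfty_ge; exact: num_real.
  by rewrite balance_le_exp// (ltW (balance_gt0 t0)).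
- exact: cvg_cst.
- apply: (cvg_comp _ _ _ (@cvgr_expR R)).
  by apply: gt0_cvgMly; [|exact: cvg_id].
Unshelve. all: by end_near. Qed.

Section solution.
Context {R : realType} (G : R -> R) (hG : solves_integral_equation G).
Notation mu := (@lebesgue_measure R).
Implicit Types (x y : R).

Lemma integrable_decay_solution x :
  mu.-integrable `[x, +oo[ (EFin \o (decay \o G)).
Proof. by have [] := hG (- x); rewrite opprK. Qed.

Lemma solutionE : G = tail_integral (decay \o G) \o -%R.
Proof. by apply/funext => x; have [_ ->] := hG x. Qed.

Lemma continuous_solution : continuous G.
Proof.
rewrite solutionE => x; apply: continuous_comp; first exact: oppr_continuous.
by apply: continuous_tail_integral; exact: integrable_decay_solution.
Qed.

Lemma continuous_decay_solution : continuous (decay \o G).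
Proof.
move=> x; apply: continuous_comp; first exact: continuous_solution.
exact: continuous_decay.
Qed.

Lemma is_derive_solution x : is_derive x 1 G (decay (G (- x))).
Proof.
rewrite [X in is_derive _ _ X _]solutionE.
have ? := is_derive_tail_integral (- x) integrable_decay_solution
  continuous_decay_solution.
by apply: is_derive_eq; rewrite /GRing.scale/= mulrN1 opprK.
Qed.

Lemma derive1_solution : G^`()%classic = fun x => decay (G (- x)).
Proof.
apply/funext => x; rewrite derive1E.
by have [_ ->] := is_derive_solution x.
Qed.

Lemma solutionN_cvg0 : G (- x) @[x --> +oo] --> 0.
Proof.
rewrite solutionE; under eq_fun do rewrite /= opprK.
exact: (tail_integral_cvg0 (integrable_decay_solution 0)).
Qed.

Lemma decay_solutionN_cvg1 : decay (G (- x)) @[x --> +oo] --> (1 : R).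
Proof.
rewrite -(@decay0 R); apply: continuous_cvg; first exact: continuous_decay.
exact: solutionN_cvg0.
Qed.

(** [G'(x) = decay (G (- x))] tends to 1, so the slope is eventually at least
    1/2. *)
Lemma solution_cvgy : G x @[x --> +oo] --> +oo.
Proof.
have : \forall x \near +oo, 1 / 2 <= decay (G (- x)).
  apply: (cvgr_ge _ decay_solutionN_cvg1); lra.
move=> [A [_ hA]].
apply/cvgryPge => M; near=> x.
have Ax : A + 1 < x by near: x; apply: nbhs_pinfty_gt; exact: num_real.
have [|c] := MVT Ax (fun x _ => is_derive_solution x).
  by apply: continuous_subspaceT; exact: continuous_solution.
rewrite in_itv/= => /andP[Ac cx] GE.
have kc : 1 / 2 <= decay (G (- c)) by apply: hA; lra.
have : x >= A + 1 + 2 * (M - G (A + 1)).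
  by near: x; apply: nbhs_pinfty_ge; exact: num_real.
nra.
Unshelve. all: by end_near. Qed.

(** The flow [u' = decay v], [v' = - decay u] followed by [(G x, G (- x))]
    preserves [balance u + balance v]. *)
Lemma balance_solution x : balance (G x) + balance (G (- x)) = 1.
Proof.
pose E x := balance (G x) + balance (G (- x)).
have E0 (z : R) : is_derive z 1 E 0.
  have hN := is_derive1_comp (is_derive_solution (- z)) (is_deriveN (is_derive_id z (1 : R))).
  have hB := is_derive1_comp (is_derive_balance (G z)) (is_derive_solution z).
  have hBN := is_derive1_comp (is_derive_balance (G (- z))) hN.
  have /is_derive_eq := is_deriveD hB hBN; apply.
  by rewrite opprK; ring.
have Ecst z : E z = E x by exact: is_derive_0_is_cst.
have E1 : E z @[z --> +oo] --> (0 + balance 0 : R).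
  apply: cvgD; first exact: cvg_comp solution_cvgy balance_cvg0.
  by apply: continuous_cvg; [exact: continuous_balance|exact: solutionN_cvg0].
rewrite balance0 add0r in E1.
have Ex : E z @[z --> +oo] --> E x.
  by under eq_fun do rewrite Ecst; exact: cvg_cst.
exact: cvg_unique Ex E1.
Qed.

(** The smaller [m] of [G z] and [G (- z)] never vanishes: otherwise one of the
    two values is 0 and the other one nonnegative, and their balances add up to
    more than [balance 0 = 1]. As [m] is nonnegative far away, where the
    integrand defining [G (- z)] is positive, the intermediate value theorem
    excludes that [m] is ever negative. *)
Lemma solution_gt0 x : 0 < G x.
Proof.
pose m z := Num.min (G z) (G (- z)).
have cm : continuous m.
  move=> z; apply: continuous_min; first exact: continuous_solution.
  apply: continuous_comp; first exact: oppr_continuous.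
  exact: continuous_solution.
have m_neq0 z : m z != 0.
  apply/eqP => mz; have := balance_solution z; move: mz.
  rewrite /m minElt; case: ifPn => [lt0|]; last rewrite -leNgt => le0.
    move=> Gz; rewrite Gz in lt0 *.
    by have := balance_gt0 (ltW lt0); rewrite balance0; lra.
  move=> Gz; rewrite Gz in le0 *.
  by have := balance_gt0 le0; rewrite balance0; lra.
have [N xN mN] : exists2 z, `|x| <= z & 0 <= m z.
  have [A [_ hA]] : \forall z \near +oo, 0 < G z.
    by apply: (cvgryPgt _).1; exact: solution_cvgy.
  exists (Num.max `|x| (A + 1)); first by rewrite le_max lexx.
  set z := Num.max _ _; have Az : A < z by rewrite lt_max ltrDl ltr01 orbT.
  rewrite /m le_min (ltW (hA _ Az))/= solutionE /= opprK.
  apply: Rintegral_ge0 => t /=; rewrite in_itv/= andbT => zt.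
  by rewrite ltW// decay_gt0// ltW// hA// (lt_le_trans Az).
have xN' : - N <= x <= N by rewrite -ler_norml.
have mx : 0 < m x.
  rewrite ltNge; apply/negP => mx0; have /andP[_ xN2] := xN'.
  have [|c _ mc] := @IVT _ m x N 0 xN2 (continuous_subspaceT cm).
    by rewrite ge_min le_max mx0 mN orbT.
  by have := m_neq0 c; rewrite mc eqxx.
by move: mx; rewrite /m lt_min => /andP[].
Qed.

Lemma solution_lt x y : x < y -> G x < G y.
Proof.
move=> xy; have [|c _ GE] := MVT xy (fun x _ => is_derive_solution x).
  by apply: continuous_subspaceT; exact: continuous_solution.
by rewrite -subr_gt0 GE mulr_gt0 ?subr_gt0// decay_gt0// ltW// solution_gt0.
Qed.

End solution.

(** * The implicit function *)

Section conjugate.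
Context {R : realType} (y : R -> R) (hy : solves_implicit_equation y).
Implicit Types s t : R.

Lemma conjugate_gt0 t : 0 < t -> 0 < y t.
Proof. by case/hy. Qed.

Lemma balance_conjugate t : 0 < t -> balance t + balance (y t) = 1.
Proof. by case/hy. Qed.

Lemma conjugate_unique s t : 0 < s -> 0 < t -> balance s + balance t = 1 ->
  y s = t.
Proof.
move=> s0 t0 st; apply: balance_inj; rewrite ?ltW// ?conjugate_gt0//.
by have := balance_conjugate s0; lra.
Qed.

(** The implicit equation is symmetric in its two unknowns. *)
Lemma conjugateK t : 0 < t -> y (y t) = t.
Proof.
move=> t0; apply: conjugate_unique => //; first exact: conjugate_gt0.
by rewrite addrC balance_conjugate.
Qed.

Lemma conjugate_lt s t : 0 < s -> s < t -> y t < y s.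
Proof.
move=> s0 st; have t0 := lt_trans s0 st.
have bst := balance_lt (ltW s0) st.
have hs := balance_conjugate s0; have ht := balance_conjugate t0.
rewrite ltNge; apply/negP; rewrite le_eqVlt => /predU1P[yst|].
  by rewrite yst in hs; lra.
by move/(balance_lt (ltW (conjugate_gt0 s0))); lra.
Qed.

(** A decreasing involution is continuous: the preimage of an interval under [y]
    is the interval between the images of its ends. *)
Lemma continuous_conjugate t : 0 < t -> {for t, continuous y}.
Proof.
move=> t0; apply/cvgrPdist_lt => e e0.
have yt0 := conjugate_gt0 t0.
pose b1 := y t + e; pose b2 := Num.max (y t - e) (y t / 2).
(* The second argument of the maximum keeps [b2] positive. *)
have b2_gt0 : 0 < b2 by rewrite lt_max divr_gt0// orbT.
have b2_lt : b2 < y t by rewrite gt_max; lra.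
have b1_gt : y t < b1 by rewrite /b1; lra.
have b1_gt0 := lt_trans yt0 b1_gt.
have yb1 : y b1 < t by rewrite -[ltRHS]conjugateK// conjugate_lt.
have yb2 : t < y b2 by rewrite -[ltLHS]conjugateK// conjugate_lt.
near=> s.
have s1 : y b1 < s by near: s; exact: lt_nbhsr.
have s2 : s < y b2 by near: s; exact: lt_nbhsl.
have s0 : 0 < s by exact: lt_trans (conjugate_gt0 b1_gt0) s1.
have ys1 : y s < b1 by rewrite -[ltRHS]conjugateK// conjugate_lt// conjugate_gt0.
have ys2 : b2 < y s by rewrite -[ltLHS]conjugateK// conjugate_lt.
have : y t - e <= b2 by rewrite le_max lexx.
rewrite ltr_norml /b1 in ys1 *; lra.
Unshelve. all: by end_near. Qed.
End conjugate.

(** * Substitution and finiteness *)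

Lemma integrable_expRN_norm {R : realType} (k : R) : 0 < k ->
  (@lebesgue_measure R).-integrable setT (fun x => (expR (- (k * `|x|)))%:E).
Proof.
move=> k0; set f := fun x : R => expR (- (k * `|x|)).
have cf : continuous f.
  move=> x; apply: continuous_comp; last exact: continuous_expR.
  apply: continuousN; apply: continuousM; first exact: cvg_cst.
  exact: norm_continuous.
pose P x : R := - k^-1 * expR (- (k * x)).
have dP (x : R) : is_derive x 1 P (expR (- (k * x))).
  apply: is_derive_eq; rewrite /GRing.scale/=; field; exact: lt0r_neq0.
have f0 x : 0 <= f x by exact: expR_ge0.
apply/integrableP; split.
  by apply/measurable_EFinP; exact: continuous_measurable_fun.
under eq_integral do rewrite /= ger0_norm ?expR_ge0//.
rewrite ge0_symfun_integralT//; last by move=> x; rewrite /= normrN.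
rewrite -set_itvcy (@ge0_continuous_FTC2y _ f P 0 0)//.
- exact: ltry.
- exact: continuous_subspaceT.
- rewrite [X in _ --> X](_ : _ = - k^-1 * 0); last by rewrite mulr0.
  apply: cvgM; first exact: cvg_cst.
  apply: (cvg_comp _ _ _ (@cvgr_expR R)).
  by apply: gt0_cvgMry; [|exact: cvg_id].
- apply: cvg_at_right_filter; apply: differentiable_continuous.
  by apply/derivable1_diffP; have [] := dP 0.
- move=> x; rewrite in_itv/= andbT => x0.
  by rewrite derive1E; have [_ ->] := dP x; rewrite /f gtr0_norm.
Qed.

Section substitution.
Context {R : realType} (G y : R -> R).
Hypotheses (hG : solves_integral_equation G) (hy : solves_implicit_equation y).
Notation mu := (@lebesgue_measure R).

Let h x := G x * decay (G x).

Lemma conjugate_solution x : y (G x) = G (- x).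
Proof.
apply: (conjugate_unique hy); [exact: solution_gt0..|].
exact: balance_solution.
Qed.

Lemma solution_weight_ge0 x : 0 <= h x.
Proof. by have Gx := solution_gt0 hG x; rewrite mulr_ge0 ?ltW// decay_gt0// ltW. Qed.

Lemma continuous_solution_weight : continuous h.
Proof.
move=> x; apply: cvgM; first exact: continuous_solution.
exact: continuous_decay_solution.
Qed.

Lemma measurable_conjugate : measurable_fun (`]0, +oo[%classic : set R) y.
Proof.
apply: open_continuous_measurable_fun; first exact: interval_open.
by move=> t; rewrite inE/= in_itv/= andbT => /(continuous_conjugate hy).
Qed.

(** The substitution [t = G x] on the half-line from [- b], followed by the
    reflection of [x]. It is done on rays since [G] does not map the line onto itself. *)
Lemma substitution_ray b :
  (\int[mu]_(t in `[G (- b), +oo[) (y t)%:E =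
   \int[mu]_(x in `]-oo, b]) (h x)%:E)%E.
Proof.
have cG := continuous_solution hG.
have cG' : continuous (fun x => decay (G (- x))).
  move=> x; apply: (@continuous_comp _ _ _ -%R (decay \o G)); first exact: oppr_continuous.
  exact: (continuous_decay_solution hG).
have dG := derive1_solution hG.
rewrite (@increasing_ge0_integration_by_substitutiony _ G y (- b)).
- rewrite -[in RHS](opprK b) ge0_integration_by_substitutionNy.
  + apply: eq_integral => x _.
    by rewrite dG /h fctE /= conjugate_solution.
  + exact/continuous_subspaceT/continuous_solution_weight.
  + by move=> x _; exact: solution_weight_ge0.
- by move=> s t _ _; exact: solution_lt.
- by rewrite dG => x _; exact: cG'.
- by rewrite dG; apply/cvg_ex; eexists; apply/cvg_at_right_filter/cG'.
- by rewrite dG; apply/cvg_ex; eexists; exact: decay_solutionN_cvg1.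
- split; first by move=> x _; have [] := is_derive_solution hG x.
  exact/cvg_at_right_filter/cG.
- exact: solution_cvgy.
- apply: continuous_in_subspaceT => t; rewrite inE/= in_itv/= andbT => Gt.
  exact/(continuous_conjugate hy)/lt_le_trans/Gt/solution_gt0.
- move=> t; rewrite in_itv/= andbT => Gt.
  exact/ltW/(conjugate_gt0 hy)/lt_trans/Gt/solution_gt0.
Qed.

Lemma integral_conjugate :
  (\int[mu]_(t in `]0%R, +oo[) (y t)%:E = \int[mu]_x (h x)%:E)%E.
Proof.
pose A n := `[G (- n%:R), +oo[%classic; pose B n := `]-oo, n%:R : R]%classic.
have UA : \bigcup_n A n = `]0, +oo[%classic.
  apply/seteqP; split=> [t [n _]|t]; rewrite /A /= !in_itv/= !andbT.
    exact/lt_le_trans/solution_gt0.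
  move=> t0.
  have [M [_ hM]] : \forall x \near +oo, G (- x) < t.
    by apply: (cvgr_lt _ (solutionN_cvg0 hG)).
  exists (Num.truncn `|M|).+1 => //=; rewrite in_itv/= andbT ltW// hM//.
  by rewrite (le_lt_trans (ler_norm _))// truncnS_gt.
have UB : \bigcup_n B n = setT.
  apply/seteqP; split=> // x _; exists (Num.truncn `|x|).+1 => //=.
  by rewrite /B /= in_itv/= (le_trans (ler_norm _))// ltW// truncnS_gt.
rewrite -UA -UB.
have A0 n t : A n t -> 0 < t.
  rewrite /A /= in_itv/= andbT; exact/lt_le_trans/solution_gt0.
have cA : (\int[mu]_(t in A n) (y t)%:E @[n --> \oo] -->
           \int[mu]_(t in \bigcup_n A n) (y t)%:E)%E.
  apply: ge0_nondecreasing_set_cvg_integral => //.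
  - apply/nondecreasing_seqP => n; rewrite subsetEset; apply: subset_itvr.
    by rewrite bnd_simp ltW// (solution_lt hG)// ltrN2 ltr_nat.
  - by move=> n; exact: measurable_itv.
  - move=> n; apply/measurable_EFinP.
    apply: measurable_funS measurable_conjugate => // t /A0 t0.
    by rewrite /= in_itv/= t0.
  - by move=> n t /A0 t0; rewrite lee_fin ltW// (conjugate_gt0 hy).
have cB : (\int[mu]_(x in B n) (h x)%:E @[n --> \oo] -->
           \int[mu]_(x in \bigcup_n B n) (h x)%:E)%E.
  apply: ge0_nondecreasing_set_cvg_integral => //.
  - apply/nondecreasing_seqP => n; rewrite subsetEset; apply: subset_itvl.
    by rewrite bnd_simp ler_nat.
  - by move=> n; exact: measurable_itv.
  - move=> n; apply/measurable_EFinP/measurable_funTS.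
    exact: continuous_measurable_fun continuous_solution_weight.
  - by move=> n x _; rewrite lee_fin solution_weight_ge0.
have AB n : (\int[mu]_(t in A n) (y t)%:E = \int[mu]_(x in B n) (h x)%:E)%E.
  exact: substitution_ray.
rewrite (funext AB) in cA.
exact: cvg_unique cA cB.
Qed.

(** Between 0 and [x] the slope [decay (G (- c))] is at least [decay (G 0)], because
    [G (- c) <= G 0] and [decay] decreases on the nonnegative half-line. *)
Lemma solution_ge_affine x : 0 <= x -> decay (G 0) * x <= G x.
Proof.
rewrite le_eqVlt => /predU1P[<-|x0]; first by rewrite mulr0 ltW// solution_gt0.
have [|c] := MVT x0 (fun x _ => is_derive_solution hG x).
  by apply: continuous_subspaceT; exact: continuous_solution.
rewrite in_itv/= subr0 => /andP[c0 _] GE.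
have : decay (G 0) <= decay (G (- c)).
  apply: decay_le; first exact/ltW/solution_gt0.
  by apply/ltW/solution_lt => //; rewrite oppr_lt0.
have := solution_gt0 hG 0; nra.
Qed.

(** For negative [x] the bound is read off the reflected point, through
    [1 - balance (G x) = balance (G (- x))]. *)
Lemma solution_weight_le x : h x <= 16 * expR (- (decay (G 0) / 2 * `|x|)).
Proof.
apply: (@le_trans _ _ (16 * expR (- (G `|x| / 2)))).
  have [x0|x0] := leP 0 x.
    rewrite ger0_norm//; exact/mul_decay_le_exp/ltW/solution_gt0.
  rewrite ltr0_norm//; apply: (le_trans (mul_decay_le_balance (ltW (solution_gt0 hG x)))).
  have := balance_le_exp (ltW (solution_gt0 hG (- x))).
  have := balance_solution hG x; have := expR_ge0 (- (G (- x) / 2)); lra.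
rewrite ler_pM2l// ler_expR lerN2.
by have := solution_ge_affine (normr_ge0 x); lra.
Qed.

Lemma integrable_solution_weight :
  mu.-integrable setT (fun x => (h x)%:E).
Proof.
have k0 : 0 < decay (G 0) / 2.
  by rewrite divr_gt0// decay_gt0// ltW// solution_gt0.
apply: le_integrable (integrableZl _ 16 (integrable_expRN_norm k0)) => //.
  apply/measurable_EFinP.
  exact: continuous_measurable_fun continuous_solution_weight.
move=> x _; rewrite lee_fin ger0_norm ?solution_weight_ge0//.
by rewrite ger0_norm ?mulr_ge0 ?expR_ge0// solution_weight_le.
Qed.

Lemma integrable_conjugate :
  mu.-integrable `]0, +oo[ (fun t => (y t)%:E).
Proof.
apply/integrableP; split.
  by apply/measurable_EFinP; exact: measurable_conjugate.
have -> : (\int[mu]_(t in `]0%R, +oo[) `|(y t)%:E| =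
           \int[mu]_(t in `]0%R, +oo[) (y t)%:E)%E.
  apply: eq_integral => t; rewrite inE/= in_itv/= andbT => t0.
  by rewrite gtr0_norm// (conjugate_gt0 hy).
rewrite integral_conjugate; apply: integrable_lty => //.
exact: integrable_solution_weight.
Qed.
End substitution.

Theorem proposition2p2 (R : realType) (G y : R -> R)
    (hG : solves_integral_equation G) (hy : solves_implicit_equation y) :
  [/\ (@lebesgue_measure R).-integrable setT
        (fun x => (G x * (1 + G x) * expR (- G x))%:E),
      (@lebesgue_measure R).-integrable `]0, +oo[ (fun x => (y x)%:E)
    & 1 / 2 * \int[@lebesgue_measure R]_x (G x * (1 + G x) * expR (- G x)) =
      1 / 2 * \int[@lebesgue_measure R]_(x in `]0, +oo[) y x].
Proof.
have hE x : G x * (1 + G x) * expR (- G x) = G x * decay (G x).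
  by rewrite /decay mulrA.
split.
- under eq_fun do rewrite hE.
  exact: integrable_solution_weight hG.
- exact: integrable_conjugate hG hy.
- congr (_ * _); under eq_Rintegral do rewrite hE.
  by rewrite /Rintegral (integral_conjugate hG hy).
Qed.
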